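(* Let $\beta_1,\dots,\beta_{n_0}\in\mathbb F\setminus\{0\}$ and $M_\beta=\operatorname{Diag}(\beta_1,\dots,\beta_{n_0})$. Define the matrices over $\mathbb B$ $$H=\begin{bmatrix}(\overline{G_0}M_\beta)_{\mathbb B}&\mathbf 0&(\overline{G_0}M_\beta)_{\mathbb B}\\ \mathbf 0&(\overline{G_0}M_\beta)_{\mathbb B}&(\overline{G_0}M_\beta)_{\mathbb B}\end{bmatrix},\qquad H^0=\begin{bmatrix}(\phi M_\beta)_{\mathbb B}&\mathbf 0&(\phi M_\beta)_{\mathbb B}\\(\overline{G_0}M_\beta)_{\mathbb B}&\mathbf 0&(\overline{G_0}M_\beta)_{\mathbb B}\\ \mathbf 0&(\phi M_\beta)_{\mathbb B}&(\phi M_\beta)_{\mathbb B}\\ \mathbf 0&(\overline{G_0}M_\beta)_{\mathbb B}&(\overline{G_0}M_\beta)_{\mathbb B}\end{bmatrix}.$$ If $\operatorname{rank}_{\mathbb B}(H^0)-\operatorname{rank}_{\mathbb B}(H)=2m$ (the rank condition for the addition $w=u+v$ with the same leakage functions $x\mapsto\operatorname{Tr}_{\mathbb F/\mathbb B}(\beta_jx)$ used on the $j$-th shares of $u$, $v$ and $w$), then $$\operatorname{rank}_{\mathbb B}\begin{bmatrix}(\phi M_\beta)_{\mathbb B}\\(\overline{G_0}M_\beta)_{\mathbb B}\end{bmatrix}=\operatorname{rank}_{\mathbb B}\bigl((\overline{G_0}M_\beta)_{\mathbb B}\bigr)+m,$$ i.e. $\beta_1,\dots,\beta_{n_0}$ satisfy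 the rank condition for the base code $C_0$ alone.
   Context: $\mathbb B=\mathbb F_q$ is a finite field and $\mathbb F$ is an extension field of $\mathbb B$ of degree $m$. Base code: $C_0$ is an $\mathbb F$-linear code of length $n_0+1$ and dimension $k_0$ admitting a generator matrix (with $k_0$ linearly independent rows) of the form $G_0=\begin{bmatrix}-1&\phi\\0&\overline{G_0}\end{bmatrix}$, where $\phi\in\mathbb F^{n_0}$ is nonzero and $\overline{G_0}\in\mathbb F^{(k_0-1)\times n_0}$. Column expansion: fix a basis of $\mathbb F$ over $\mathbb B$. For $M\in\mathbb F^{a\times b}$, $M_{\mathbb B}\in\mathbb B^{am\times b}$ is obtained by replacing each entry by the column vector of its $m$ coordinates in this basis. $\operatorname{Tr}_{\mathbb F/\mathbb B}$ denotes the field trace. *)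

(* Defs.v *)
From mathcomp Require Import all_boot all_order all_algebra all_field.

Set Implicit Arguments.
Unset Strict Implicit.
Unset Printing Implicit Defensive.

Import GRing.Theory.
Local Open Scope ring_scope.

Definition generator_matrix (F : fieldType) (k n : nat)
    (G : 'M[F]_(k, n)) (C : {vspace 'rV[F]_n}) : Prop :=
  row_free G /\ (forall x : 'rV[F]_n, (x \in C) = (x <= G)%MS).

Definition base_generator (F : fieldType) (k n : nat)
    (phi : 'rV[F]_n) (Gbar : 'M[F]_(k, n)) : 'M[F]_(1 + k, 1 + n) :=
  block_mx (-1)%:M phi 0 Gbar.

(* [mxvec] is row-major, so row [mxvec_index i l] of the expansion is the l-th
   row of the block of m rows coming from row i of M. *)
Definition column_expansion (B : fieldType) (F : fieldExtType B) (m : nat)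
    (e : m.-tuple F) (a b : nat) (M : 'M[F]_(a, b)) : 'M[B]_(a * m, b) :=
  \matrix_(r < a * m, j < b)
    mxvec (\matrix_(i < a, l < m) coord e l (M i j)) 0 r.

Lemma column_expansionE (B : fieldType) (F : fieldExtType B) (m : nat)
    (e : m.-tuple F) (a b : nat) (M : 'M[F]_(a, b)) i l j :
  column_expansion e M (mxvec_index i l) j = coord e l (M i j).
Proof. by rewrite mxE mxvecE mxE. Qed.

Definition addition_H (B : fieldType) (F : fieldExtType B) (m : nat)
    (e : m.-tuple F) (k n : nat) (Gbar : 'M[F]_(k, n)) (beta : 'rV[F]_n) :
    'M[B]_(k * m + k * m, n + (n + n)) :=
  let g := column_expansion e (Gbar *m diag_mx beta) in
  col_mx (row_mx g (row_mx 0 g))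
         (row_mx 0 (row_mx g g)).

Definition addition_H0 (B : fieldType) (F : fieldExtType B) (m : nat)
    (e : m.-tuple F) (k n : nat) (phi : 'rV[F]_n) (Gbar : 'M[F]_(k, n))
    (beta : 'rV[F]_n) :
    'M[B]_(1 * m + (k * m + (1 * m + k * m)), n + (n + n)) :=
  let p := column_expansion e (phi *m diag_mx beta) in
  let g := column_expansion e (Gbar *m diag_mx beta) in
  col_mx (row_mx p (row_mx 0 p))
 (col_mx (row_mx g (row_mx 0 g))
 (col_mx (row_mx 0 (row_mx p p))
         (row_mx 0 (row_mx g g)))).

(* Main.v *)
Require Import Defs.
From mathcomp Require Import all_boot all_order all_algebra all_field.

Import GRing.Theory.
Local Open Scope ring_scope.

(** The row space of [[A, 0, A], [0, A, A]] is the image of two independent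
    copies of the row space of A under the injective map
    (x, y) |-> (x, y, x + y), so its rank is 2 rank(A).  Up to a permutation of
    rows, H and H^0 both have this shape, and the rank condition for the
    addition is twice the rank condition for the base code. *)

Lemma mxrank_sum_shares (K : fieldType) (a n : nat) (A : 'M[K]_(a, n)) :
  \rank (col_mx (row_mx A (row_mx 0 A)) (row_mx 0 (row_mx A A)))
  = (2 * \rank A)%N.
Proof.
pose S : 'M[K]_(n + n, n + (n + n)) :=
  block_mx 1%:M (row_mx 0 1%:M) 0 (row_mx 1%:M 1%:M).
have S_free : row_free S.
  (* [S] is the matrix of (x, y) |-> (x, y, x + y); projecting to the first two blocks undoes it. *)
  apply/row_freeP; exists (col_mx (row_mx 1%:M 0) (col_mx (row_mx 0 1%:M) 0)).
  rewrite mul_block_col !mul_row_col !mul0mx !mul1mx !addr0 !add0r.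
  by rewrite scalar_mx_block.
have -> : col_mx (row_mx A (row_mx 0 A)) (row_mx 0 (row_mx A A))
          = block_mx A 0 0 A *m S.
  rewrite -[LHS]/(block_mx A (row_mx 0 A) 0 (row_mx A A)) mulmx_block.
  by rewrite !mul_mx_row !mulmx1 !mulmx0 row_mx0 !addr0 add0r.
by rewrite mxrankMfree // rank_diag_block_mx addnn mul2n.
Qed.

(** Equality of row spaces suffices for ranks and avoids a cast between the two row counts. *)
Lemma col_mx_eqmxA (K : fieldType) (a b c n : nat)
    (X : 'M[K]_(a, n)) (Y : 'M[K]_(b, n)) (Z : 'M[K]_(c, n)) :
  (col_mx X (col_mx Y Z) :=: col_mx (col_mx X Y) Z)%MS.
Proof.
apply: eqmx_trans (eqmx_sym (addsmxE _ _)) _.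
apply: eqmx_trans (adds_eqmx (eqmx_refl _) (eqmx_sym (addsmxE _ _))) _.
rewrite addsmxA; apply: eqmx_trans (addsmxE _ _).
exact: adds_eqmx (addsmxE _ _) (eqmx_refl _).
Qed.

Theorem mainTheorem4 (B : finFieldType) (F : fieldExtType B) (m : nat)
    (hm : \dim {: F} = m)
    (e : m.-tuple F) (he : basis_of {: F} e)
    (n0 k0 : nat) (C0 : {vspace 'rV[F]_(1 + n0)}) (hC0 : \dim C0 = k0)
    (phi : 'rV[F]_n0) (hphi : phi != 0) (Gbar : 'M[F]_(k0.-1, n0))
    (hG0 : generator_matrix (base_generator phi Gbar) C0)
    (beta : 'rV[F]_n0) (hbeta : forall j : 'I_n0, beta 0 j != 0)
    (hrank : (\rank (addition_H0 e phi Gbar beta)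
              - \rank (addition_H e Gbar beta) = 2 * m)%N) :
  \rank (col_mx (column_expansion e (phi *m diag_mx beta))
                (column_expansion e (Gbar *m diag_mx beta)))
  = (\rank (column_expansion e (Gbar *m diag_mx beta)) + m)%N.
Proof.
move: hrank; rewrite /addition_H0 /addition_H.
set p := column_expansion e (phi *m _); set g := column_expansion e (Gbar *m _).
rewrite col_mx_eqmxA mxrank_sum_shares.
have col_row a b c d (U : 'M[B]_(a, c)) (V : 'M_(a, d)) (U' : 'M_(b, c)) V' :
    col_mx (row_mx U V) (row_mx U' V') = row_mx (col_mx U U') (col_mx V V').
  exact: block_mxEh.
(* Fixing the upper left block [U] merges only the rows of [p] with those of [g]; the outer split
   into two shares survives. *)
rewrite !(col_row _ _ _ _ p) !(col_row _ _ _ _ 0) !(col_row _ _ _ _ p) !col_mx0.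
rewrite mxrank_sum_shares -mulnBr => /eqP.
rewrite eqn_pmul2l // => /eqP rank_diff.
(* Subtraction on [nat] is truncated, so the rank of [g] must be bounded by that of the stacked
   matrix. *)
by rewrite -[X in _ = (_ + X)%N]rank_diff subnKC // -addsmxE mxrankS // addsmxSr.
Qed.
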